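(* Let $I,J\subset\mathbb{R}$ be open intervals with $0\in J$, and let $\alpha: I\times J\to E_1^3$, $(s,t)\mapsto\alpha(s,t)$, be a smooth solution of the vortex filament equation $\alpha_t=\alpha_s\times_L\alpha_{ss}$ such that each curve $\alpha(\cdot,t)$ is timelike and $\|\alpha_s(s,0)\|=1$ for all $s$. Then: (1) There exists a parallel normal frame $(T,E_1,E_2)^T(\cdot,t)$, $T=\alpha_s$, for each timelike curve $\alpha(\cdot,t)$ (depending smoothly on $(s,t)$) such that $$\begin{bmatrix} T \\ E_1 \\ E_2 \end{bmatrix}_s=\begin{bmatrix} 0&k_1&k_2 \\ k_1&0&0 \\ k_2&0&0 \end{bmatrix}\begin{bmatrix} T \\ E_1 \\ E_2 \end{bmatrix},$$ $$\begin{bmatrix} T \\ E_1 \\ E_2 \end{bmatrix}_t=\begin{bmatrix} 0&-(k_2)_s&(k_1)_s \\ -(k_2)_s&0&\frac12(k_1^2+k_2^2) \\ (k_1)_s&-\frac12(k_1^2+k_2^2)&0 \end{bmatrix}\begin{bmatrix} T \\ E_1 \\ E_2 \end{bmatrix},$$ where $k_1(\cdot,t)$ and $k_2(\cdot,t)$ are the principal curvatures of $\alpha(\cdot,t)$ along $E_1(\cdot,t)$ and $E_2(\cdot,t)$, respectively. (2) With $k_1,k_2$ as in (1), the function $q=k_1+ik_2$ is a solution of the NLS$^-$ equation $$iq_t+q_{ss}-\frac12\|q\|^2q=0,$$ where $\|q\|^2=k_1^2+k_2^2$.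
   Context: Minkowski 3-space $E_1^3$ is $\mathbb{R}^3$ with the Lorentzian inner product $\langle x,y\rangle_L=-x_1y_1+x_2y_2+x_3y_3$. The norm is $\|x\|=\sqrt{|\langle x,x\rangle_L|}$. The Lorentzian vector product is $x\times_L y=(-x_2y_3+x_3y_2,\;x_3y_1-x_1y_3,\;x_1y_2-x_2y_1)$. A vector $x$ is spacelike, lightlike or timelike if $\langle x,x\rangle_L$ is $>0$, $=0$, $<0$ respectively; a curve is timelike if all of its tangent vectors are timelike. Subscripts $s$ and $t$ denote partial derivatives. For a solution of the vortex filament equation with $\|\alpha_s(s,0)\|=1$ for all $s$, one has $\|\alpha_s(s,t)\|=1$ for all $(s,t)$ (known fact), so $s$ is an arclength parameter for each $\alpha(\cdot,t)$ and $T=\alpha_s$ is the unit tangent. A parallel (normal) frame of a unit speed timelike curve with unit tangent $T$ is an orthonormal frame $(T,E_1,E_2)$ along the curve with $\langle T,T\rangle_L=-1$, $\langle E_1,E_1\rangle_L=\langle E_2,E_2\rangle_L=1$, all mutual products zero, and $\langle (E_1)_s,E_2\rangle_L=\langle E_1,(E_2)_s\rangle_L=0$. The principal curvatures $k_1,k_2$ of the curve along $E_1,E_2$ are the coefficients in $T_s=k_1E_1+k_2E_2$. *)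

(* Defs.v *)
From Stdlib Require Import Reals.
From Coquelicot Require Import Coquelicot.
Open Scope R_scope.

(** ** Minkowski 3-space *)

(* [R * R * R] is [(R * R) * R]; addition and scaling are Coquelicot's product
   module operations [plus] and [scal]. *)
Definition E13 : Type := (R * R * R)%type.

Definition x1 (v : E13) : R := fst (fst v).
Definition x2 (v : E13) : R := snd (fst v).
Definition x3 (v : E13) : R := snd v.

Definition linner (x y : E13) : R :=
  - (x1 x * x1 y) + x2 x * x2 y + x3 x * x3 y.

Definition lnorm (x : E13) : R := sqrt (Rabs (linner x x)).

Definition lcross (x y : E13) : E13 :=
  (- (x2 x * x3 y) + x3 x * x2 y,
   x3 x * x1 y - x1 x * x3 y,
   x1 x * x2 y - x2 x * x1 y).

Definition timelike (x : E13) : Prop := linner x x < 0.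

(** ** Intervals, smoothness and derivatives *)

Definition is_open_interval (I : R -> Prop) : Prop :=
  exists a b : Rbar, forall x : R, I x <-> Rbar_lt a x /\ Rbar_lt x b.

(* [ex_diff_n f n s t] says that all iterated partial derivatives of [f] of
   order at most [n] exist and are jointly continuous at [(s, t)]. As [I] and
   [J] are open, quantifying over all orders and all points is C^infinity on
   the rectangle; the values of [f] outside it are irrelevant. *)
Definition smooth (I J : R -> Prop) (f : R -> R -> R) : Prop :=
  forall (n : nat) (s t : R), I s -> J t -> ex_diff_n f n s t.

Definition smooth_vec (I J : R -> Prop) (f : R -> R -> E13) : Prop :=
  smooth I J (fun s t => x1 (f s t)) /\
  smooth I J (fun s t => x2 (f s t)) /\
  smooth I J (fun s t => x3 (f s t)).

Definition smooth_C (I J : R -> Prop) (f : R -> R -> C) : Prop :=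
  smooth I J (fun s t => Re (f s t)) /\ smooth I J (fun s t => Im (f s t)).

Definition Derive_vec (c : R -> E13) (u : R) : E13 :=
  (Derive (fun z => x1 (c z)) u,
   Derive (fun z => x2 (c z)) u,
   Derive (fun z => x3 (c z)) u).

Definition Derive_C (f : R -> C) (u : R) : C :=
  (Derive (fun z => Re (f z)) u, Derive (fun z => Im (f z)) u).

Definition ds (f : R -> R -> R) (s t : R) : R := Derive (fun u => f u t) s.

Definition ds_vec (f : R -> R -> E13) (s t : R) : E13 :=
  Derive_vec (fun u => f u t) s.
Definition dt_vec (f : R -> R -> E13) (s t : R) : E13 :=
  Derive_vec (fun u => f s u) t.

Definition ds_C (f : R -> R -> C) (s t : R) : C := Derive_C (fun u => f u t) s.
Definition dt_C (f : R -> R -> C) (s t : R) : C := Derive_C (fun u => f s u) t.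

(** ** Timelike curves and parallel frames *)

Definition timelike_curve (I : R -> Prop) (c : R -> E13) : Prop :=
  forall s, I s -> timelike (Derive_vec c s).

Definition parallel_frame (I : R -> Prop) (c E1 E2 : R -> E13) : Prop :=
  let T := Derive_vec c in
  forall s, I s ->
    linner (T s) (T s) = -1 /\
    linner (E1 s) (E1 s) = 1 /\
    linner (E2 s) (E2 s) = 1 /\
    linner (T s) (E1 s) = 0 /\
    linner (T s) (E2 s) = 0 /\
    linner (E1 s) (E2 s) = 0 /\
    linner (Derive_vec E1 s) (E2 s) = 0 /\
    linner (E1 s) (Derive_vec E2 s) = 0.

(* The product of the row [(a, b, c)] with the column [(T, E1, E2)^T]. *)
Definition row (a b c : R) (T E1 E2 : E13) : E13 :=
  plus (plus (scal a T) (scal b E1)) (scal c E2).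

Definition principal_curvatures (I : R -> Prop) (c E1 E2 : R -> E13)
    (k1 k2 : R -> R) : Prop :=
  let T := Derive_vec c in
  forall s, I s ->
    Derive_vec T s = plus (scal (k1 s) (E1 s)) (scal (k2 s) (E2 s)).

(** ** The two evolution equations *)

Definition vortex_filament (I J : R -> Prop) (alpha : R -> R -> E13) : Prop :=
  forall s t, I s -> J t ->
    dt_vec alpha s t = lcross (ds_vec alpha s t) (ds_vec (ds_vec alpha) s t).

Definition frame_s_equations (I J : R -> Prop) (T E1 E2 : R -> R -> E13)
    (k1 k2 : R -> R -> R) : Prop :=
  forall s t, I s -> J t ->
    let r a b c := row a b c (T s t) (E1 s t) (E2 s t) in
    ds_vec T s t  = r 0        (k1 s t) (k2 s t) /\
    ds_vec E1 s t = r (k1 s t) 0        0 /\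
    ds_vec E2 s t = r (k2 s t) 0        0.

Definition frame_t_equations (I J : R -> Prop) (T E1 E2 : R -> R -> E13)
    (k1 k2 : R -> R -> R) : Prop :=
  forall s t, I s -> J t ->
    let r a b c := row a b c (T s t) (E1 s t) (E2 s t) in
    let w := / 2 * (k1 s t ^ 2 + k2 s t ^ 2) in
    dt_vec T s t  = r 0             (- ds k2 s t) (ds k1 s t) /\
    dt_vec E1 s t = r (- ds k2 s t) 0             w /\
    dt_vec E2 s t = r (ds k1 s t)   (- w)         0.

Definition adapted_frame (I J : R -> Prop) (alpha E1 E2 : R -> R -> E13)
    (k1 k2 : R -> R -> R) : Prop :=
  smooth_vec I J E1 /\
  smooth_vec I J E2 /\
  (forall t, J t ->
    parallel_frame I (fun s => alpha s t) (fun s => E1 s t) (fun s => E2 s t)) /\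
  (forall t, J t ->
    principal_curvatures I (fun s => alpha s t)
      (fun s => E1 s t) (fun s => E2 s t) (fun s => k1 s t) (fun s => k2 s t)) /\
  frame_s_equations I J (ds_vec alpha) E1 E2 k1 k2 /\
  frame_t_equations I J (ds_vec alpha) E1 E2 k1 k2.

Definition NLS_minus (I J : R -> Prop) (q : R -> R -> C) : Prop :=
  smooth_C I J q /\
  forall s t, I s -> J t ->
    (Ci * dt_C q s t + ds_C (ds_C q) s t
       - RtoC (/ 2) * RtoC (Cmod (q s t) ^ 2) * q s t)%C = RtoC 0.

(* Main.v *)
Require Import Defs.
From Stdlib Require Import Reals Lra Lia Classical.
From Coquelicot Require Import Coquelicot.
Open Scope R_scope.

(** Differentiating the vortex filament equation in [s] gives [T_t = T x T_ss] for
    the tangent [T]: it preserves [<T, T> = -1], and in any positively oriented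
    orthonormal frame [(T, F1, F2)] the normal vector [T_t] is the normal part of [T_ss]
    turned by a right angle ([tangent_evolution], [tangent_unit], [filament_frame]).

    A first frame is given by an explicit formula in [T] ([exists_filament_frame]).
    Rotating its normal plane by an angle [theta] adds [d theta] to the connection form
    [<dF1, F2>], so a frame with [<E1_s, E2> = 0] and
    [<E1_t, E2> = 1/2 <T_s, T_s> = 1/2 (k1^2 + k2^2)] exists once
    [theta_s = - <F1_s, F2>] and [theta_t = 1/2 <T_s, T_s> - <F1_t, F2>] can be solved.
    This is an exactness problem on a rectangle: the right-hand sides form a closed
    form, which is the curvature computation [connection_form_closed], and the Poincare
    lemma [closed_form_exact] integrates it.  The solution is smooth since its partial
    derivatives are.  All other entries of the two matrices are forced, because the
    derivative of an orthonormal frame is skew for the Lorentzian product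
    ([skew_motion_of_frame]) and a vector is determined by its products with the frame
    ([eq_row]).

    For the second part, [k1 = <T_s, E1>] and [- k2_s = <T_t, E1>], and similarly for
    [E2].  Taking the [t]-derivative of the former and the [s]-derivative of the latter,
    the symmetry of [T_st] relates [k1_t] to [k2_ss]; the remaining terms are read off the
    frame equations ([curvature_evolution], [adapted_frame_NLS]).  The two real equations
    obtained in this way are the imaginary and the real part of the NLS equation. *)

(** * Open intervals *)

Lemma open_interval_locally (I : R -> Prop) (x : R) :
  is_open_interval I -> I x -> locally x I.
Proof.
intros [a [b hab]] hx.
apply hab in hx.
apply filter_imp with (fun y : R => Rbar_lt a y /\ Rbar_lt y b).
  intros y hy; now apply hab.
apply filter_and; [now apply open_Rbar_gt | now apply open_Rbar_lt].
Qed.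

Lemma open_interval_convex (I : R -> Prop) (a b x : R) :
  is_open_interval I -> I a -> I b -> Rmin a b <= x <= Rmax a b -> I x.
Proof.
intros [l [r hlr]] ha hb hx.
apply hlr in ha; apply hlr in hb; apply hlr; destruct ha, hb.
split.
- apply Rbar_lt_le_trans with (Rmin a b); [|apply hx].
  now apply Rmin_case.
- apply Rbar_le_lt_trans with (Rmax a b); [apply hx|].
  now apply Rmax_case.
Qed.

Lemma open_rectangle_locally (I J : R -> Prop) (P : R -> R -> Prop) (s t : R) :
  is_open_interval I -> is_open_interval J -> I s -> J t ->
  (forall u v, I u -> J v -> P u v) -> locally_2d P s t.
Proof.
intros hI hJ hs ht hP.
destruct (open_interval_locally I s hI hs) as [d1 h1].
destruct (open_interval_locally J t hJ ht) as [d2 h2].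
exists (mkposreal _ (Rmin_stable_in_posreal d1 d2)); simpl; intros u v hu hv.
apply hP.
- apply h1; apply Rlt_le_trans with (1 := hu); apply Rmin_l.
- apply h2; apply Rlt_le_trans with (1 := hv); apply Rmin_r.
Qed.

Lemma zero_derive_constant (J : R -> Prop) (g : R -> R) :
  is_open_interval J -> (forall v, J v -> is_derive g v 0) ->
  forall a b, J a -> J b -> g a = g b.
Proof.
intros hJ hg a b ha hb.
destruct (Rtotal_order a b) as [h | [-> | h]]; [| easy |].
- apply eq_is_derive; [|easy]; intros t ht; apply hg.
  apply (open_interval_convex J a b); [easy..|].
  rewrite Rmin_left, Rmax_right; lra.
- symmetry; apply eq_is_derive; [|easy]; intros t ht; apply hg.
  apply (open_interval_convex J b a); [easy..|].
  rewrite Rmin_left, Rmax_right; lra.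
Qed.

(** * Smooth functions on a rectangle *)

(** The finite-order version of smoothness, on which the closure properties are
    proved by induction on the order. *)
Definition smooth_upto (n : nat) (I J : R -> Prop) (f : R -> R -> R) : Prop :=
  forall s t, I s -> J t -> ex_diff_n f n s t.

Definition dt (f : R -> R -> R) (s t : R) : R := Derive (fun v => f s v) t.

Definition has_partials (I J : R -> Prop) (f fs ft : R -> R -> R) : Prop :=
  forall s t, I s -> J t ->
    is_derive (fun u => f u t) s (fs s t) /\ is_derive (fun v => f s v) t (ft s t).

Lemma ex_diff_n_continuity n f s t : ex_diff_n f n s t -> continuity_2d_pt f s t.
Proof. now destruct n; intros [h _]. Qed.

Lemma smooth_upto_pred n I J f : smooth_upto (S n) I J f -> smooth_upto n I J f.
Proof.
intros h s t hs ht.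
apply (ex_diff_n_m (S n)); [lia | now apply h].
Qed.

Lemma smooth_upto_ext n I J f g :
  is_open_interval I -> is_open_interval J ->
  (forall s t, I s -> J t -> f s t = g s t) ->
  smooth_upto n I J f -> smooth_upto n I J g.
Proof.
intros hI hJ e h s t hs ht.
apply (ex_diff_n_ext_loc f); [|now apply h].
now apply (open_rectangle_locally I J).
Qed.

Lemma smooth_ext I J f g :
  is_open_interval I -> is_open_interval J ->
  (forall s t, I s -> J t -> f s t = g s t) ->
  smooth I J f -> smooth I J g.
Proof.
intros hI hJ e h n s t.
apply (smooth_upto_ext n I J f g hI hJ e).
intros u v; apply h.
Qed.

Lemma smooth_partials I J f :
  smooth I J f -> has_partials I J f (ds f) (dt f).
Proof.
intros h s t hs ht.
destruct (h 1%nat s t hs ht) as [_ [h1 [h2 _]]].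
split; now apply Derive_correct.
Qed.

Lemma smooth_is_derive_s I J f s t :
  smooth I J f -> I s -> J t -> is_derive (fun u => f u t) s (ds f s t).
Proof. intros hf hs ht; exact (proj1 (smooth_partials I J f hf s t hs ht)). Qed.

Lemma smooth_is_derive_t I J f s t :
  smooth I J f -> I s -> J t -> is_derive (fun v => f s v) t (dt f s t).
Proof. intros hf hs ht; exact (proj2 (smooth_partials I J f hf s t hs ht)). Qed.

Lemma smooth_ds I J f : smooth I J f -> smooth I J (ds f).
Proof. intros h n s t hs ht; now destruct (h (S n) s t hs ht) as [_ [_ [_ [h1 _]]]]. Qed.

Lemma smooth_dt I J f : smooth I J f -> smooth I J (dt f).
Proof. intros h n s t hs ht; now destruct (h (S n) s t hs ht) as [_ [_ [_ [_ h1]]]]. Qed.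

(** One continuous partial derivative and the mere existence of the other give
    differentiability, hence joint continuity.  This is what lets the notion of
    smoothness, which asks for continuity at every order, be checked on the
    partial derivatives alone. *)
Lemma has_partials_continuity I J f fs ft :
  is_open_interval I -> is_open_interval J -> has_partials I J f fs ft ->
  forall s t, I s -> J t -> continuity_2d_pt fs s t -> continuity_2d_pt f s t.
Proof.
intros hI hJ hf s t hs ht hc.
apply continuity_2d_pt_filterlim.
apply (filterdiff_continuous (fun u : R * R => f (fst u) (snd u)) (s, t)).
eexists.
apply (is_derive_filterdiff f s t fs (ft s t)).
- apply (locally_2d_locally (fun u v => is_derive (fun z => f z v) u (fs u v))).
  apply (open_rectangle_locally I J); [easy..|].
  intros u v hu hv; exact (proj1 (hf u v hu hv)).
- exact (proj2 (hf s t hs ht)).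
- now apply continuity_2d_pt_filterlim in hc.
Qed.

Lemma smooth_upto_S n I J f fs ft :
  is_open_interval I -> is_open_interval J -> has_partials I J f fs ft ->
  smooth_upto n I J fs -> smooth_upto n I J ft -> smooth_upto (S n) I J f.
Proof.
intros hI hJ hf h1 h2 s t hs ht.
split; [|split; [|split; [|split]]].
- apply (has_partials_continuity I J f fs ft); [easy..|].
  now apply ex_diff_n_continuity with n, h1.
- exists (fs s t); exact (proj1 (hf s t hs ht)).
- exists (ft s t); exact (proj2 (hf s t hs ht)).
- revert s t hs ht; apply (smooth_upto_ext n I J fs); [easy..| |easy].
  intros s t hs ht; symmetry; exact (is_derive_unique _ _ _ (proj1 (hf s t hs ht))).
- revert s t hs ht; apply (smooth_upto_ext n I J ft); [easy..| |easy].
  intros s t hs ht; symmetry; exact (is_derive_unique _ _ _ (proj2 (hf s t hs ht))).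
Qed.

Lemma smooth_of_partials I J f fs ft :
  is_open_interval I -> is_open_interval J -> has_partials I J f fs ft ->
  smooth I J fs -> smooth I J ft -> smooth I J f.
Proof.
intros hI hJ hf h1 h2 n s t hs ht.
apply (ex_diff_n_m (S n)); [lia|].
revert s t hs ht; apply (smooth_upto_S n I J f fs ft); try easy.
- exact (h1 n).
- exact (h2 n).
Qed.

Lemma smooth_upto_partials n I J f :
  smooth_upto (S n) I J f ->
  has_partials I J f (ds f) (dt f) /\
  smooth_upto n I J (ds f) /\ smooth_upto n I J (dt f).
Proof.
intros h; split; [|split]; intros s t hs ht;
  destruct (h s t hs ht) as [_ [h1 [h2 [h3 h4]]]]; try easy.
split; now apply Derive_correct.
Qed.

Lemma smooth_upto_plus n I J f g :
  is_open_interval I -> is_open_interval J ->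
  smooth_upto n I J f -> smooth_upto n I J g ->
  smooth_upto n I J (fun s t => f s t + g s t).
Proof.
intros hI hJ; revert f g; induction n as [|n IH]; intros f g hf hg.
- intros s t hs ht; split; [|easy].
  now apply continuity_2d_pt_plus; [apply hf | apply hg].
- apply smooth_upto_partials in hf as [pf [fs ft]].
  apply smooth_upto_partials in hg as [pg [gs gt]].
  apply (smooth_upto_S n I J _ (fun s t => ds f s t + ds g s t)
           (fun s t => dt f s t + dt g s t)); [easy.. | | now apply IH | now apply IH].
  intros s t hs ht; destruct (pf s t hs ht), (pg s t hs ht).
  split; now apply (is_derive_plus (V := R_NormedModule)).
Qed.

Lemma smooth_upto_mult n I J f g :
  is_open_interval I -> is_open_interval J ->
  smooth_upto n I J f -> smooth_upto n I J g ->
  smooth_upto n I J (fun s t => f s t * g s t).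
Proof.
intros hI hJ; revert f g; induction n as [|n IH]; intros f g hf hg.
- intros s t hs ht; split; [|easy].
  now apply continuity_2d_pt_mult; [apply hf | apply hg].
- assert (hf' := smooth_upto_pred _ _ _ _ hf).
  assert (hg' := smooth_upto_pred _ _ _ _ hg).
  apply smooth_upto_partials in hf as [pf [fs ft]].
  apply smooth_upto_partials in hg as [pg [gs gt]].
  apply (smooth_upto_S n I J _ (fun s t => ds f s t * g s t + f s t * ds g s t)
           (fun s t => dt f s t * g s t + f s t * dt g s t)); [easy.. | | | ];
    try (apply smooth_upto_plus; try easy; now apply IH).
  intros s t hs ht; destruct (pf s t hs ht), (pg s t hs ht).
  split; apply (is_derive_mult (K := R_AbsRing) (fun u => _) (fun u => _)); try easy;
    intros; apply Rmult_comm.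
Qed.

(** The successive derivatives of the outer function are given as a sequence
    [phi], so that the induction can pass from [phi k] to [phi (S k)] by the chain
    rule. *)
Lemma smooth_upto_comp n I J (D : R -> Prop) (phi : nat -> R -> R) f k :
  is_open_interval I -> is_open_interval J ->
  (forall j x, D x -> is_derive (phi j) x (phi (S j) x)) ->
  (forall s t, I s -> J t -> D (f s t)) ->
  smooth_upto n I J f -> smooth_upto n I J (fun s t => phi k (f s t)).
Proof.
intros hI hJ hphi hD; revert k; induction n as [|n IH]; intros k hf.
- intros s t hs ht; split; [|easy].
  apply continuity_1d_2d_pt_comp; [|now apply hf].
  apply derivable_continuous_pt.
  exists (phi (S k) (f s t)); now apply is_derive_Reals, hphi, hD.
- assert (hf' := smooth_upto_pred _ _ _ _ hf).
  apply smooth_upto_partials in hf as [pf [fs ft]].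
  apply (smooth_upto_S n I J _ (fun s t => ds f s t * phi (S k) (f s t))
           (fun s t => dt f s t * phi (S k) (f s t))); [easy.. | | | ];
    try (apply smooth_upto_mult; try easy; now apply IH).
  intros s t hs ht; destruct (pf s t hs ht).
  split; apply (is_derive_comp (V := R_NormedModule) (phi k)); try easy;
    now apply hphi, hD.
Qed.

Lemma smooth_const I J c : smooth I J (fun _ _ => c).
Proof.
assert (h : forall n c s t, ex_diff_n (fun _ _ => c) n s t).
  induction n as [|n IH]; intros c' s t; (split; [apply continuity_2d_pt_const|]); [easy|].
  split; [apply ex_derive_const|split; [apply ex_derive_const|]].
  split; (apply (ex_diff_n_ext_loc (fun _ _ => 0)); [|easy]);
    exists (mkposreal _ Rlt_0_1); intros; now rewrite Derive_const.
intros n s t _ _; apply h.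
Qed.

Lemma smooth_plus I J f g :
  is_open_interval I -> is_open_interval J ->
  smooth I J f -> smooth I J g -> smooth I J (fun s t => f s t + g s t).
Proof.
intros hI hJ hf hg n; apply (smooth_upto_plus n I J); [easy..| |];
  intros s t; auto.
Qed.

Lemma smooth_mult I J f g :
  is_open_interval I -> is_open_interval J ->
  smooth I J f -> smooth I J g -> smooth I J (fun s t => f s t * g s t).
Proof.
intros hI hJ hf hg n; apply (smooth_upto_mult n I J); [easy..| |];
  intros s t; auto.
Qed.

Lemma smooth_opp I J f :
  is_open_interval I -> is_open_interval J ->
  smooth I J f -> smooth I J (fun s t => - f s t).
Proof.
intros hI hJ hf.
apply (smooth_ext I J (fun s t => -1 * f s t)); [easy..| |].
  intros; ring.
apply smooth_mult; auto using smooth_const.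
Qed.

Lemma smooth_minus I J f g :
  is_open_interval I -> is_open_interval J ->
  smooth I J f -> smooth I J g -> smooth I J (fun s t => f s t - g s t).
Proof. intros; apply smooth_plus; auto; now apply smooth_opp. Qed.

Lemma smooth_comp I J (D : R -> Prop) (phi : nat -> R -> R) f :
  is_open_interval I -> is_open_interval J ->
  (forall j x, D x -> is_derive (phi j) x (phi (S j) x)) ->
  (forall s t, I s -> J t -> D (f s t)) ->
  smooth I J f -> smooth I J (fun s t => phi 0%nat (f s t)).
Proof.
intros hI hJ hphi hD hf n; apply (smooth_upto_comp n I J D); auto.
intros s t; auto.
Qed.

Lemma smooth_cos I J f :
  is_open_interval I -> is_open_interval J ->
  smooth I J f -> smooth I J (fun s t => cos (f s t)).
Proof.
intros hI hJ hf.
apply (smooth_ext I J (fun s t => cos (f s t + INR 0 * (PI / 2)))); [easy..| |].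
  intros; f_equal; simpl; ring.
(* The k-th derivative of the cosine is a shift by k quarter turns. *)
apply (smooth_comp I J (fun _ => True) (fun k x => cos (x + INR k * (PI / 2)))); auto.
intros k x _; auto_derive; [easy|].
rewrite S_INR.
replace (x + (INR k + 1) * (PI / 2)) with (PI / 2 + (x + INR k * (PI / 2))) by field.
assert (e := sin_cos (x + INR k * (PI / 2))); lra.
Qed.

Lemma smooth_sin I J f :
  is_open_interval I -> is_open_interval J ->
  smooth I J f -> smooth I J (fun s t => sin (f s t)).
Proof.
intros hI hJ hf.
apply (smooth_ext I J (fun s t => cos (PI / 2 - f s t))); [easy..| |].
  intros; apply cos_shift.
apply smooth_cos; auto.
apply smooth_minus; auto; apply smooth_const.
Qed.

(** The k-th derivative of [x^p] is [p (p-1) ... (p-k+1) x^(p-k)]. *)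
Lemma smooth_Rpower I J p f :
  is_open_interval I -> is_open_interval J ->
  (forall s t, I s -> J t -> 0 < f s t) ->
  smooth I J f -> smooth I J (fun s t => Rpower (f s t) p).
Proof.
intros hI hJ h0 hf.
set (c := fix c (k : nat) :=
       match k with O => 1 | S k => c k * (p - INR k) end).
apply (smooth_ext I J (fun s t => c 0%nat * Rpower (f s t) (p - INR 0))); [easy..| |].
  intros; simpl; rewrite Rminus_0_r; ring.
apply (smooth_comp I J (fun x => 0 < x) (fun k x => c k * Rpower x (p - INR k))); auto.
intros k x hx.
replace (c (S k) * Rpower x (p - INR (S k)))
  with (c k * ((p - INR k) * Rpower x (p - INR k - 1))).
  apply (is_derive_scal (fun x => Rpower x (p - INR k))).
  now apply is_derive_Reals, derivable_pt_lim_power.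
rewrite S_INR; simpl c.
replace (p - (INR k + 1)) with (p - INR k - 1) by ring; ring.
Qed.

Lemma ds_dt_comm I J f :
  is_open_interval I -> is_open_interval J -> smooth I J f ->
  forall s t, I s -> J t -> ds (dt f) s t = dt (ds f) s t.
Proof.
intros hI hJ hf s t hs ht.
apply (Schwarz f s t).
- apply (open_rectangle_locally I J); [easy..|]; intros u v hu hv.
  destruct (hf 2%nat u v hu hv) as [_ [h1 [h2 [[_ [h3 [h4 _]]] [_ [h5 [h6 _]]]]]]].
  auto.
- apply (ex_diff_n_continuity 0).
  exact (smooth_ds _ _ _ (smooth_dt _ _ _ hf) 0%nat s t hs ht).
- apply (ex_diff_n_continuity 0).
  exact (smooth_dt _ _ _ (smooth_ds _ _ _ hf) 0%nat s t hs ht).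
Qed.

(** * Closed forms on a rectangle *)

Lemma smooth_continuity I J f s t :
  smooth I J f -> I s -> J t -> continuity_2d_pt f s t.
Proof. intros hf hs ht; exact (ex_diff_n_continuity 0 f s t (hf 0%nat s t hs ht)). Qed.

Lemma smooth_continuous_s I J f s t :
  smooth I J f -> I s -> J t -> continuous (fun u => f u t) s.
Proof.
intros hf hs ht; apply (ex_derive_continuous (V := R_NormedModule)).
eexists; exact (smooth_is_derive_s I J f s t hf hs ht).
Qed.

Lemma smooth_continuous_t I J f s t :
  smooth I J f -> I s -> J t -> continuous (fun v => f s v) t.
Proof.
intros hf hs ht; apply (ex_derive_continuous (V := R_NormedModule)).
eexists; exact (smooth_is_derive_t I J f s t hf hs ht).
Qed.

Lemma is_derive_RInt_open (I : R -> Prop) (g : R -> R) (a x : R) :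
  is_open_interval I -> I a -> I x -> (forall y, I y -> continuous g y) ->
  is_derive (fun y => RInt g a y) x (g x).
Proof.
intros hI ha hx hg.
apply (is_derive_RInt (V := R_NormedModule) g _ a); [|now apply hg].
apply filter_imp with I; [|now apply open_interval_locally].
intros y hy; apply (RInt_correct (V := R_CompleteNormedModule)).
apply (ex_RInt_continuous (V := R_CompleteNormedModule)).
intros z hz; apply hg; now apply (open_interval_convex I a y).
Qed.

Lemma is_derive_RInt_smooth I J A (a s t : R) :
  is_open_interval I -> is_open_interval J -> smooth I J A ->
  I a -> I s -> J t ->
  is_derive (fun v => RInt (fun u => A u v) a s) t (RInt (fun u => dt A u t) a s).
Proof.
intros hI hJ hA ha hs ht.
assert (hin : forall u, Rmin a s <= u <= Rmax a s -> I u).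
  intros u hu; now apply (open_interval_convex I a s).
apply (is_derive_RInt_param (fun v u => A u v)).
- apply filter_imp with J; [|now apply open_interval_locally].
  intros v hv u hu; eexists; exact (smooth_is_derive_t I J A u v hA (hin u hu) hv).
- intros u hu.
  assert (h := smooth_continuity I J (dt A) u t (smooth_dt _ _ _ hA) (hin u hu) ht).
  intros eps; destruct (h eps) as [d hd]; exists d; intros v w hv hw; now apply hd.
- apply filter_imp with J; [|now apply open_interval_locally].
  intros v hv; apply (ex_RInt_continuous (V := R_CompleteNormedModule)).
  intros u hu; apply (smooth_continuous_s I J); auto.
Qed.

(** Poincare lemma on a rectangle.  The primitive integrates along the path that
    runs from [(s0, t0)] to [(s0, t)] and then to [(s, t)]; its [t]-derivative is
    found by differentiating under the integral sign, where closedness turns the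
    integrand into [ds B]. *)
Lemma closed_form_exact I J A B :
  is_open_interval I -> is_open_interval J ->
  smooth I J A -> smooth I J B ->
  (forall s t, I s -> J t -> dt A s t = ds B s t) ->
  exists theta, smooth I J theta /\ has_partials I J theta A B.
Proof.
intros hI hJ hA hB hAB.
assert (main : exists theta, has_partials I J theta A B).
  destruct (classic (exists s0 t0, I s0 /\ J t0)) as [[s0 [t0 [hs0 ht0]]] | hempty]; cycle 1.
    (* An empty rectangle has no base point, but nothing to prove either. *)
    exists (fun _ _ => 0); intros s t hs ht; case hempty; now exists s, t.
  exists (fun s t => RInt (fun u => A u t) s0 s + RInt (fun v => B s0 v) t0 t).
  intros s t hs ht; split.
  - replace (A s t) with (A s t + 0) by ring.
    apply (is_derive_plus (V := R_NormedModule));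
      [|apply (is_derive_const (K := R_AbsRing) (V := R_NormedModule))].
    apply (is_derive_RInt_open I (fun u => A u t)); auto.
    intros u hu; now apply (smooth_continuous_s I J).
  - assert (e : RInt (fun u => dt A u t) s0 s = B s t - B s0 t).
      apply is_RInt_unique.
      apply (is_RInt_ext (fun u => ds B u t)).
        intros u hu; symmetry; apply hAB; [|easy].
        apply (open_interval_convex I s0 s); auto; lra.
      apply (is_RInt_derive (V := R_CompleteNormedModule) (fun u => B u t));
        intros u hu; assert (hu' := open_interval_convex I s0 s u hI hs0 hs hu).
      + exact (smooth_is_derive_s I J B u t hB hu' ht).
      + apply (smooth_continuous_s I J); auto; now apply smooth_ds.
    replace (B s t) with ((B s t - B s0 t) + B s0 t) by ring.
    rewrite <- e.
    apply (is_derive_plus (V := R_NormedModule)).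
      now apply (is_derive_RInt_smooth I J).
    apply (is_derive_RInt_open J (fun v => B s0 v)); auto.
    intros v hv; now apply (smooth_continuous_t I J).
destruct main as [theta h]; exists theta; split; [|easy].
now apply (smooth_of_partials I J theta A B).
Qed.

(** * Lorentzian linear algebra *)

Lemma E13_eq (v w : E13) : x1 v = x1 w -> x2 v = x2 w -> x3 v = x3 w -> v = w.
Proof.
destruct v as [[a b] c], w as [[a' b'] c']; unfold x1, x2, x3; simpl.
now intros -> -> ->.
Qed.

Lemma linner_sym (v w : E13) : linner v w = linner w v.
Proof. unfold linner; ring. Qed.

Lemma linner_plus (v v' w : E13) : linner (plus v v') w = linner v w + linner v' w.
Proof. unfold linner, x1, x2, x3; simpl; unfold plus; simpl; ring. Qed.

Lemma linner_scal (a : R) (v w : E13) : linner (scal a v) w = a * linner v w.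
Proof. unfold linner, x1, x2, x3; simpl; unfold scal; simpl; unfold mult; simpl; ring. Qed.

Lemma linner_plus_r (v w w' : E13) : linner v (plus w w') = linner v w + linner v w'.
Proof. rewrite linner_sym, linner_plus, !(linner_sym v); ring. Qed.

Lemma linner_scal_r (a : R) (v w : E13) : linner v (scal a w) = a * linner v w.
Proof. rewrite linner_sym, linner_scal, (linner_sym v); ring. Qed.

Definition orthonormal_frame (T E1 E2 : E13) : Prop :=
  linner T T = -1 /\ linner E1 E1 = 1 /\ linner E2 E2 = 1 /\
  linner T E1 = 0 /\ linner T E2 = 0 /\ linner E1 E2 = 0.

(** [linner (lcross u v) w] is the determinant of [(u, v, w)]; the sign comes from
    the determinant of the metric being [-1]. *)
Lemma gram_determinant (u v w : E13) :
  linner (lcross u v) w ^ 2 =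
  - (linner u u * (linner v v * linner w w - linner v w ^ 2)
     - linner u v * (linner u v * linner w w - linner v w * linner u w)
     + linner u w * (linner u v * linner v w - linner v v * linner u w)).
Proof. unfold linner, lcross, x1, x2, x3; simpl; ring. Qed.

(** The determinant of the frame squares to 1, so it does not vanish, and Cramer's
    rule recovers a vector from its three products with the frame. *)
Lemma orthonormal_frame_ext (T E1 E2 v w : E13) :
  orthonormal_frame T E1 E2 ->
  linner v T = linner w T -> linner v E1 = linner w E1 -> linner v E2 = linner w E2 ->
  v = w.
Proof.
intros [h1 [h2 [h3 [h4 [h5 h6]]]]] e0 e1 e2.
assert (hd := gram_determinant T E1 E2).
rewrite h1, h2, h3, h4, h5, h6 in hd.
set (d := linner (lcross T E1) E2) in *.
assert (hd0 : d <> 0) by (intros h; rewrite h in hd; lra).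
assert (cramer : forall (u : E13) (z : E13),
  d * linner u z = linner u T * linner (lcross E1 E2) z
    + linner u E1 * linner (lcross E2 T) z + linner u E2 * linner (lcross T E1) z).
  intros u z; unfold d, linner, lcross, x1, x2, x3; simpl; ring.
assert (e : forall z, linner v z = linner w z).
  intros z; apply (Rmult_eq_reg_l d); [|easy].
  now rewrite !cramer, e0, e1, e2.
(* The metric is nondegenerate: testing against the standard basis reads off
   the coordinates. *)
apply E13_eq.
- generalize (e (1, 0, 0)); unfold linner, x1, x2, x3; simpl; lra.
- generalize (e (0, 1, 0)); unfold linner, x1, x2, x3; simpl; lra.
- generalize (e (0, 0, 1)); unfold linner, x1, x2, x3; simpl; lra.
Qed.

Lemma linner_row (a b c : R) (T E1 E2 v : E13) :
  linner (row a b c T E1 E2) v = a * linner T v + b * linner E1 v + c * linner E2 v.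
Proof. unfold row; now rewrite !linner_plus, !linner_scal. Qed.

Lemma linner_row_r (a b c : R) (T E1 E2 v : E13) :
  linner v (row a b c T E1 E2) = a * linner v T + b * linner v E1 + c * linner v E2.
Proof. rewrite linner_sym, linner_row, !(linner_sym v); ring. Qed.

(** The timelike leg of the frame has square [-1], whence the sign of [a]. *)
Lemma eq_row (T E1 E2 v : E13) (a b c : R) :
  orthonormal_frame T E1 E2 ->
  linner v T = - a -> linner v E1 = b -> linner v E2 = c ->
  v = row a b c T E1 E2.
Proof.
intros hF ha hb hc; apply (orthonormal_frame_ext T E1 E2); [easy|..];
  rewrite linner_row; destruct hF as [h1 [h2 [h3 [h4 [h5 h6]]]]];
  rewrite ?(linner_sym E1 T), ?(linner_sym E2 T), ?(linner_sym E2 E1),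
    ?ha, ?hb, ?hc, ?h1, ?h2, ?h3, ?h4, ?h5, ?h6; ring.
Qed.

Lemma parseval (T E1 E2 v w : E13) :
  orthonormal_frame T E1 E2 ->
  linner v w = - (linner v T * linner w T) + linner v E1 * linner w E1
               + linner v E2 * linner w E2.
Proof.
intros hF.
rewrite (eq_row T E1 E2 v (- linner v T) (linner v E1) (linner v E2)) at 1; auto; [|ring].
rewrite linner_row, !(linner_sym w); ring.
Qed.

(** * Differentiation of vector fields *)

Definition is_derive_vec (c : R -> E13) (u : R) (d : E13) : Prop :=
  is_derive (fun z => x1 (c z)) u (x1 d) /\
  is_derive (fun z => x2 (c z)) u (x2 d) /\
  is_derive (fun z => x3 (c z)) u (x3 d).

Lemma is_derive_vec_unique c u d : is_derive_vec c u d -> Derive_vec c u = d.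
Proof. intros [h1 [h2 h3]]; apply E13_eq; now apply is_derive_unique. Qed.

Lemma is_derive_Rmult (f g : R -> R) (u df dg : R) :
  is_derive f u df -> is_derive g u dg ->
  is_derive (fun z => f z * g z) u (df * g u + f u * dg).
Proof. intros hf hg; apply (is_derive_mult (K := R_AbsRing)); auto; exact Rmult_comm. Qed.

Lemma is_derive_Rplus (f g : R -> R) (u df dg : R) :
  is_derive f u df -> is_derive g u dg ->
  is_derive (fun z => f z + g z) u (df + dg).
Proof. exact (is_derive_plus (V := R_NormedModule) f g u df dg). Qed.

Lemma is_derive_Ropp (f : R -> R) (u df : R) :
  is_derive f u df -> is_derive (fun z => - f z) u (- df).
Proof. exact (is_derive_opp (V := R_NormedModule) f u df). Qed.

Lemma is_derive_linner v w u dv dw :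
  is_derive_vec v u dv -> is_derive_vec w u dw ->
  is_derive (fun z => linner (v z) (w z)) u (linner dv (w u) + linner (v u) dw).
Proof.
intros [v1 [v2 v3]] [w1 [w2 w3]].
evar_last.
  apply is_derive_Rplus; [apply is_derive_Rplus; [apply is_derive_Ropp|]|];
    apply is_derive_Rmult; eassumption.
unfold linner; ring.
Qed.

Lemma is_derive_vec_plus v w u dv dw :
  is_derive_vec v u dv -> is_derive_vec w u dw ->
  is_derive_vec (fun z => plus (v z) (w z)) u (plus dv dw).
Proof.
intros [v1 [v2 v3]] [w1 [w2 w3]].
split; [|split]; now apply (is_derive_plus (V := R_NormedModule)).
Qed.

Lemma is_derive_vec_scal (f : R -> R) (v : R -> E13) (u df : R) (dv : E13) :
  is_derive f u df -> is_derive_vec v u dv ->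
  is_derive_vec (fun z => scal (f z) (v z)) u (plus (scal df (v u)) (scal (f u) dv)).
Proof.
intros hf [v1 [v2 v3]].
split; [|split]; apply (is_derive_mult (K := R_AbsRing) f (fun z => _)); try easy;
    intros; apply Rmult_comm.
Qed.

Lemma is_derive_vec_lcross v w u dv dw :
  is_derive_vec v u dv -> is_derive_vec w u dw ->
  is_derive_vec (fun z => lcross (v z) (w z)) u (plus (lcross dv (w u)) (lcross (v u) dw)).
Proof.
intros [v1 [v2 v3]] [w1 [w2 w3]].
assert (bilin : forall (f g h k : R -> R) (f' g' h' k' l : R),
  is_derive f u f' -> is_derive g u g' -> is_derive h u h' -> is_derive k u k' ->
  l = (f' * g u - h' * k u) + (f u * g' - h u * k') ->
  is_derive (fun z => f z * g z - h z * k z) u l).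
  intros f g h k f' g' h' k' l hf hg hh hk ->; evar_last.
    apply is_derive_Rplus; [|apply is_derive_Ropp]; apply is_derive_Rmult; eassumption.
  ring.
split; [|split].
- apply (is_derive_ext (fun z => x3 (v z) * x2 (w z) - x2 (v z) * x3 (w z))).
    intros z; unfold lcross, x1; simpl; ring.
  eapply bilin; try eassumption.
  change (x1 (plus (lcross dv (w u)) (lcross (v u) dw))) with
    (- (x2 dv * x3 (w u)) + x3 dv * x2 (w u) + (- (x2 (v u) * x3 dw) + x3 (v u) * x2 dw)).
  ring.
- exact (bilin _ _ _ _ _ _ _ _ _ v3 w1 v1 w3 eq_refl).
- exact (bilin _ _ _ _ _ _ _ _ _ v1 w2 v2 w1 eq_refl).
Qed.

Lemma smooth_vec_ds I J V : smooth_vec I J V -> smooth_vec I J (ds_vec V).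
Proof. intros [h1 [h2 h3]]; split; [|split]; now apply smooth_ds. Qed.

Lemma smooth_vec_dt I J V : smooth_vec I J V -> smooth_vec I J (dt_vec V).
Proof. intros [h1 [h2 h3]]; split; [|split]; now apply smooth_dt. Qed.

Lemma is_derive_ds_vec I J V s t :
  smooth_vec I J V -> I s -> J t -> is_derive_vec (fun u => V u t) s (ds_vec V s t).
Proof.
intros [h1 [h2 h3]] hs ht.
split; [|split].
- exact (smooth_is_derive_s I J _ s t h1 hs ht).
- exact (smooth_is_derive_s I J _ s t h2 hs ht).
- exact (smooth_is_derive_s I J _ s t h3 hs ht).
Qed.

Lemma is_derive_dt_vec I J V s t :
  smooth_vec I J V -> I s -> J t -> is_derive_vec (fun v => V s v) t (dt_vec V s t).
Proof.
intros [h1 [h2 h3]] hs ht.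
split; [|split].
- exact (smooth_is_derive_t I J _ s t h1 hs ht).
- exact (smooth_is_derive_t I J _ s t h2 hs ht).
- exact (smooth_is_derive_t I J _ s t h3 hs ht).
Qed.

Lemma ds_linner I J V W s t :
  smooth_vec I J V -> smooth_vec I J W -> I s -> J t ->
  ds (fun s t => linner (V s t) (W s t)) s t
  = linner (ds_vec V s t) (W s t) + linner (V s t) (ds_vec W s t).
Proof.
intros hV hW hs ht; apply is_derive_unique.
apply (is_derive_linner (fun u => V u t) (fun u => W u t));
  now apply (is_derive_ds_vec I J).
Qed.

Lemma dt_linner I J V W s t :
  smooth_vec I J V -> smooth_vec I J W -> I s -> J t ->
  dt (fun s t => linner (V s t) (W s t)) s t
  = linner (dt_vec V s t) (W s t) + linner (V s t) (dt_vec W s t).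
Proof.
intros hV hW hs ht; apply is_derive_unique.
apply (is_derive_linner (fun v => V s v) (fun v => W s v));
  now apply (is_derive_dt_vec I J).
Qed.

Lemma ds_ext I J f g s t :
  is_open_interval I -> (forall s t, I s -> J t -> f s t = g s t) ->
  I s -> J t -> ds f s t = ds g s t.
Proof.
intros hI e hs ht; apply Derive_ext_loc.
apply filter_imp with I; [|now apply open_interval_locally].
intros u hu; now apply e.
Qed.

Lemma dt_ext I J f g s t :
  is_open_interval J -> (forall s t, I s -> J t -> f s t = g s t) ->
  I s -> J t -> dt f s t = dt g s t.
Proof.
intros hJ e hs ht; apply Derive_ext_loc.
apply filter_imp with J; [|now apply open_interval_locally].
intros u hu; now apply e.
Qed.

Lemma ds_vec_ext I J V W s t :
  is_open_interval I -> (forall s t, I s -> J t -> V s t = W s t) ->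
  I s -> J t -> ds_vec V s t = ds_vec W s t.
Proof.
intros hI e hs ht.
apply E13_eq; apply (ds_ext I J (fun s t => _ (V s t)) (fun s t => _ (W s t)));
  try easy; intros; now rewrite e.
Qed.

Lemma ds_dt_vec_comm I J V s t :
  is_open_interval I -> is_open_interval J -> smooth_vec I J V ->
  I s -> J t -> ds_vec (dt_vec V) s t = dt_vec (ds_vec V) s t.
Proof.
intros hI hJ [h1 [h2 h3]] hs ht.
apply E13_eq;
  [ apply (ds_dt_comm I J (fun s t => x1 (V s t)))
  | apply (ds_dt_comm I J (fun s t => x2 (V s t)))
  | apply (ds_dt_comm I J (fun s t => x3 (V s t))) ]; auto.
Qed.

(** The matrix of the derivative of an orthonormal frame lies in the Lie algebra
    of the Lorentz group: these are the six relations between its entries. *)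
Definition skew_motion (T E1 E2 T' E1' E2' : E13) : Prop :=
  linner T' T = 0 /\ linner E1' E1 = 0 /\ linner E2' E2 = 0 /\
  linner E1' T = - linner T' E1 /\ linner E2' T = - linner T' E2 /\
  linner E2' E1 = - linner E1' E2.

Lemma skew_motion_of_frame (T E1 E2 : R -> E13) (u : R) (T' E1' E2' : E13) :
  locally u (fun z => orthonormal_frame (T z) (E1 z) (E2 z)) ->
  is_derive_vec T u T' -> is_derive_vec E1 u E1' -> is_derive_vec E2 u E2' ->
  skew_motion (T u) (E1 u) (E2 u) T' E1' E2'.
Proof.
intros hF hT h1 h2.
assert (const : forall (v w : R -> E13) (v' w' : E13) (c : R),
    is_derive_vec v u v' -> is_derive_vec w u w' ->
    locally u (fun z => linner (v z) (w z) = c) ->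
    linner v' (w u) + linner w' (v u) = 0).
  intros v w v' w' c hv hw hc; rewrite (linner_sym w').
  rewrite <- (is_derive_unique _ _ _ (is_derive_linner _ _ _ _ _ hv hw)).
  rewrite (Derive_ext_loc _ (fun _ => c)) by exact hc; apply Derive_const.
unfold skew_motion.
assert (e1 : linner T' (T u) + linner T' (T u) = 0).
  apply (const _ _ _ _ (-1) hT hT); revert hF; apply filter_imp; now intros z [h _].
assert (e2 : linner E1' (E1 u) + linner E1' (E1 u) = 0).
  apply (const _ _ _ _ 1 h1 h1); revert hF; apply filter_imp; now intros z [_ [h _]].
assert (e3 : linner E2' (E2 u) + linner E2' (E2 u) = 0).
  apply (const _ _ _ _ 1 h2 h2); revert hF; apply filter_imp; now intros z [_ [_ [h _]]].
assert (e4 : linner T' (E1 u) + linner E1' (T u) = 0).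
  apply (const _ _ _ _ 0 hT h1); revert hF; apply filter_imp; now intros z [_ [_ [_ [h _]]]].
assert (e5 : linner T' (E2 u) + linner E2' (T u) = 0).
  apply (const _ _ _ _ 0 hT h2); revert hF; apply filter_imp;
    now intros z [_ [_ [_ [_ [h _]]]]].
assert (e6 : linner E1' (E2 u) + linner E2' (E1 u) = 0).
  apply (const _ _ _ _ 0 h1 h2); revert hF; apply filter_imp;
    now intros z [_ [_ [_ [_ [_ h]]]]].
repeat split; lra.
Qed.

Lemma smooth_linner I J V W :
  is_open_interval I -> is_open_interval J ->
  smooth_vec I J V -> smooth_vec I J W ->
  smooth I J (fun s t => linner (V s t) (W s t)).
Proof.
intros hI hJ [v1 [v2 v3]] [w1 [w2 w3]]; unfold linner.
auto using smooth_plus, smooth_mult, smooth_opp.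
Qed.

Lemma smooth_vec_lcross I J V W :
  is_open_interval I -> is_open_interval J ->
  smooth_vec I J V -> smooth_vec I J W ->
  smooth_vec I J (fun s t => lcross (V s t) (W s t)).
Proof.
intros hI hJ [v1 [v2 v3]] [w1 [w2 w3]]; split; [|split]; unfold lcross; simpl.
- apply smooth_plus; auto using smooth_mult, smooth_opp.
- apply smooth_minus; auto using smooth_mult, smooth_opp.
- apply smooth_minus; auto using smooth_mult, smooth_opp.
Qed.

Lemma smooth_vec_plus I J V W :
  is_open_interval I -> is_open_interval J ->
  smooth_vec I J V -> smooth_vec I J W ->
  smooth_vec I J (fun s t => plus (V s t) (W s t)).
Proof.
intros hI hJ [v1 [v2 v3]] [w1 [w2 w3]]; split; [|split].
- exact (smooth_plus I J _ _ hI hJ v1 w1).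
- exact (smooth_plus I J _ _ hI hJ v2 w2).
- exact (smooth_plus I J _ _ hI hJ v3 w3).
Qed.

Lemma smooth_vec_scal I J f V :
  is_open_interval I -> is_open_interval J ->
  smooth I J f -> smooth_vec I J V ->
  smooth_vec I J (fun s t => scal (f s t) (V s t)).
Proof.
intros hI hJ hf [v1 [v2 v3]]; split; [|split].
- exact (smooth_mult I J _ _ hI hJ hf v1).
- exact (smooth_mult I J _ _ hI hJ hf v2).
- exact (smooth_mult I J _ _ hI hJ hf v3).
Qed.

(** * The tangent indicatrix *)

(** Differentiate the equation in [s] and exchange the partial derivatives; the
    term [T_s x T_s] vanishes, leaving [T_t = T x T_ss]. *)
Lemma tangent_evolution I J alpha s t :
  is_open_interval I -> is_open_interval J -> smooth_vec I J alpha ->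
  vortex_filament I J alpha -> I s -> J t ->
  dt_vec (ds_vec alpha) s t = lcross (ds_vec alpha s t) (ds_vec (ds_vec (ds_vec alpha)) s t).
Proof.
intros hI hJ ha hv hs ht.
rewrite <- (ds_dt_vec_comm I J) by easy.
rewrite (ds_vec_ext I J _ _ s t hI hv hs ht).
assert (h1 := smooth_vec_ds _ _ _ ha); assert (h2 := smooth_vec_ds _ _ _ h1).
assert (h := is_derive_vec_lcross _ _ _ _ _ (is_derive_ds_vec _ _ _ _ _ h1 hs ht)
              (is_derive_ds_vec _ _ _ _ _ h2 hs ht)).
unfold ds_vec at 1; rewrite (is_derive_vec_unique _ _ _ h).
apply E13_eq; unfold plus, lcross, x1, x2, x3; simpl; unfold plus; simpl; ring.
Qed.

Lemma linner_lcross_l (u v : E13) : linner (lcross u v) u = 0.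
Proof. unfold linner, lcross, x1, x2, x3; simpl; ring. Qed.

(** [<T, T>] does not depend on [t], because [T_t] is orthogonal to [T]. *)
Lemma tangent_unit I J T :
  is_open_interval I -> is_open_interval J -> J 0 -> smooth_vec I J T ->
  (forall s t, I s -> J t -> linner (dt_vec T s t) (T s t) = 0) ->
  (forall s, I s -> timelike (T s 0) /\ lnorm (T s 0) = 1) ->
  forall s t, I s -> J t -> linner (T s t) (T s t) = -1.
Proof.
intros hI hJ h0 hT hort hunit s t hs ht.
rewrite (zero_derive_constant J (fun v => linner (T s v) (T s v)) hJ) with (b := 0); auto.
- destruct (hunit s hs) as [htl hn]; unfold timelike, lnorm in *.
  rewrite Rabs_left in hn by easy.
  apply (f_equal (fun x => x ^ 2)) in hn; rewrite pow2_sqrt in hn; lra.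
- intros v hv.
  replace 0 with (linner (dt_vec T s v) (T s v) + linner (T s v) (dt_vec T s v)).
    apply is_derive_linner; now apply (is_derive_dt_vec I J).
  rewrite (linner_sym (T s v)), hort; auto; ring.
Qed.

(** * Frames along the evolution *)

(** The last two fields say how a positively oriented frame sees [T_t = T x T_ss].
    They are linear in [(F1, F2)] and invariant under rotations of the normal plane,
    so that the orientation of the frame never has to be mentioned again. *)
Record filament_frame (I J : R -> Prop) (T F1 F2 : R -> R -> E13) : Prop := {
  ff_smooth1 : smooth_vec I J F1;
  ff_smooth2 : smooth_vec I J F2;
  ff_frame : forall s t, I s -> J t -> orthonormal_frame (T s t) (F1 s t) (F2 s t);
  ff_evol1 : forall s t, I s -> J t ->
    linner (dt_vec T s t) (F1 s t) = - linner (ds_vec (ds_vec T) s t) (F2 s t);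
  ff_evol2 : forall s t, I s -> J t ->
    linner (dt_vec T s t) (F2 s t) = linner (ds_vec (ds_vec T) s t) (F1 s t) }.

Lemma lcross_frame_evolution (T F v : E13) :
  orthonormal_frame T F (lcross T F) ->
  linner (lcross T v) F = - linner v (lcross T F) /\
  linner (lcross T v) (lcross T F) = linner v F.
Proof.
intros [h1 [_ [_ [h4 _]]]]; split.
- unfold linner, lcross, x1, x2, x3; simpl; ring.
- replace (linner (lcross T v) (lcross T F))
    with (linner v T * linner T F - linner T T * linner v F).
    rewrite h1, h4; ring.
  unfold linner, lcross, x1, x2, x3; simpl; ring.
Qed.

(** The vector [(x2 T, x1 T, 0)] is orthogonal to [T] and has square [1 + x3^2],
    which never vanishes.  Normalizing it and completing by the vector product with
    [T] gives a frame defined and smooth on the whole rectangle, by a formula in [T]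
    alone. *)
Lemma exists_filament_frame I J T :
  is_open_interval I -> is_open_interval J -> smooth_vec I J T ->
  (forall s t, I s -> J t -> linner (T s t) (T s t) = -1) ->
  (forall s t, I s -> J t -> dt_vec T s t = lcross (T s t) (ds_vec (ds_vec T) s t)) ->
  exists F1 F2, filament_frame I J T F1 F2.
Proof.
intros hI hJ hT hunit hev.
set (r := fun s t => Rpower (1 + x3 (T s t) * x3 (T s t)) (- / 2)).
assert (hpos : forall x, 0 < 1 + x * x) by (intros x; generalize (Rle_0_sqr x); unfold Rsqr; lra).
assert (hr : smooth I J r).
  apply smooth_Rpower; auto.
  destruct hT as [_ [_ h3]].
  apply smooth_plus; auto using smooth_const, smooth_mult.
assert (hr2 : forall s t, r s t * r s t * (1 + x3 (T s t) * x3 (T s t)) = 1).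
  intros s t; unfold r; rewrite <- Rpower_plus.
  replace (- / 2 + - / 2) with (Ropp 1) by field.
  rewrite Rpower_Ropp, Rpower_1 by easy; apply Rinv_l.
  generalize (hpos (x3 (T s t))); lra.
set (F1 := (fun s t => scal (r s t) ((x2 (T s t), x1 (T s t), 0) : E13)) : R -> R -> E13).
assert (hF1 : smooth_vec I J F1).
  apply smooth_vec_scal; auto.
  destruct hT as [h1 [h2 _]]; split; [|split]; auto; exact (smooth_const I J 0).
assert (hframe : forall s t, I s -> J t ->
    orthonormal_frame (T s t) (F1 s t) (lcross (T s t) (F1 s t))).
  intros s t hs ht.
  assert (h1 := hunit s t hs ht).
  assert (h2 : linner (F1 s t) (F1 s t) = 1).
    unfold F1; rewrite linner_scal, linner_scal_r, <- (hr2 s t), <- Rmult_assoc.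
    f_equal; revert h1; unfold linner, x1, x2, x3; simpl; lra.
  assert (h3 : linner (T s t) (F1 s t) = 0).
    unfold F1; rewrite linner_scal_r; unfold linner, x1, x2, x3; simpl; ring.
  split; [easy|split; [easy|split; [|split; [easy|split]]]].
  - replace (linner _ _) with (linner (T s t) (F1 s t) ^ 2
      - linner (T s t) (T s t) * linner (F1 s t) (F1 s t)).
      rewrite h1, h2, h3; ring.
    unfold linner, lcross, x1, x2, x3; simpl; ring.
  - now rewrite linner_sym, linner_lcross_l.
  - unfold linner, lcross, x1, x2, x3; simpl; ring.
exists F1, (fun s t => lcross (T s t) (F1 s t)); split; auto.
- now apply smooth_vec_lcross.
- intros s t hs ht; rewrite hev by easy; now apply lcross_frame_evolution, hframe.
- intros s t hs ht; rewrite hev by easy; now apply lcross_frame_evolution, hframe.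
Qed.

Lemma filament_frame_skew_ds I J T F1 F2 s t :
  is_open_interval I -> smooth_vec I J T -> filament_frame I J T F1 F2 -> I s -> J t ->
  skew_motion (T s t) (F1 s t) (F2 s t) (ds_vec T s t) (ds_vec F1 s t) (ds_vec F2 s t).
Proof.
intros hI hT [hF1 hF2 hfr _ _] hs ht.
apply (skew_motion_of_frame (fun u => T u t) (fun u => F1 u t) (fun u => F2 u t));
  try now apply (is_derive_ds_vec I J).
apply filter_imp with I; [|now apply open_interval_locally].
intros u hu; now apply hfr.
Qed.

Lemma filament_frame_skew_dt I J T F1 F2 s t :
  is_open_interval J -> smooth_vec I J T -> filament_frame I J T F1 F2 -> I s -> J t ->
  skew_motion (T s t) (F1 s t) (F2 s t) (dt_vec T s t) (dt_vec F1 s t) (dt_vec F2 s t).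
Proof.
intros hJ hT [hF1 hF2 hfr _ _] hs ht.
apply (skew_motion_of_frame (fun v => T s v) (fun v => F1 s v) (fun v => F2 s v));
  try now apply (is_derive_dt_vec I J).
apply filter_imp with J; [|now apply open_interval_locally].
intros v hv; now apply hfr.
Qed.

(** The angle [theta] of a rotation to a parallel frame must solve
    [theta_s = - <F1_s, F2>] and [theta_t = 1/2 <T_s, T_s> - <F1_t, F2>]; this is the
    compatibility of the two equations.  The mixed terms [<F1_st, F2>] cancel, and
    expanding the others in the frame leaves
    [<T_t, F2> <T_s, F1> - <T_t, F1> <T_s, F2> = <T_s, T_ss>],
    which holds since [T_t] is the normal part of [T_ss] turned by a right angle. *)
Lemma connection_form_closed I J T F1 F2 s t :
  is_open_interval I -> is_open_interval J -> smooth_vec I J T ->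
  filament_frame I J T F1 F2 -> I s -> J t ->
  dt (fun s t => - linner (ds_vec F1 s t) (F2 s t)) s t =
  ds (fun s t => / 2 * linner (ds_vec T s t) (ds_vec T s t)
                 - linner (dt_vec F1 s t) (F2 s t)) s t.
Proof.
intros hI hJ hT hf hs ht; assert (hf' := hf); destruct hf' as [hF1 hF2 hfr ev1 ev2].
assert (dT := smooth_vec_ds _ _ _ hT).
assert (ddT := smooth_vec_ds _ _ _ dT).
assert (sF1 := smooth_vec_ds _ _ _ hF1).
assert (tF1 := smooth_vec_dt _ _ _ hF1).
assert (hF := hfr s t hs ht).
assert (hA := is_derive_linner _ _ _ _ _ (is_derive_dt_vec I J _ s t sF1 hs ht)
                (is_derive_dt_vec I J _ s t hF2 hs ht)).
assert (hK := is_derive_linner _ _ _ _ _ (is_derive_ds_vec I J _ s t dT hs ht)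
                (is_derive_ds_vec I J _ s t dT hs ht)).
assert (hB := is_derive_linner _ _ _ _ _ (is_derive_ds_vec I J _ s t tF1 hs ht)
                (is_derive_ds_vec I J _ s t hF2 hs ht)).
etransitivity; [exact (is_derive_unique _ _ _ (is_derive_Ropp _ _ _ hA))|].
symmetry; etransitivity; [exact (is_derive_unique _ _ _
  (is_derive_Rplus _ _ _ _ _ (is_derive_scal _ _ (/ 2) _ hK) (is_derive_Ropp _ _ _ hB)))|].
rewrite (ds_dt_vec_comm I J F1) by auto.
rewrite (parseval _ _ _ (ds_vec F1 s t) (dt_vec F2 s t) hF).
rewrite (parseval _ _ _ (dt_vec F1 s t) (ds_vec F2 s t) hF).
rewrite (linner_sym (ds_vec (ds_vec T) s t)).
rewrite (parseval _ _ _ (ds_vec T s t) (ds_vec (ds_vec T) s t) hF).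
destruct (filament_frame_skew_ds I J T F1 F2 s t) as [s1 [s2 [s3 [s4 [s5 s6]]]]]; auto.
destruct (filament_frame_skew_dt I J T F1 F2 s t) as [t1 [t2 [t3 [t4 [t5 t6]]]]]; auto.
rewrite s1, s2, s3, s4, s5, t2, t3, t4, t5, (ev1 s t hs ht), (ev2 s t hs ht).
field.
Qed.

Definition rotated1 (theta : R -> R -> R) (F1 F2 : R -> R -> E13) (s t : R) : E13 :=
  plus (scal (cos (theta s t)) (F1 s t)) (scal (sin (theta s t)) (F2 s t)).

Definition rotated2 (theta : R -> R -> R) (F1 F2 : R -> R -> E13) (s t : R) : E13 :=
  plus (scal (- sin (theta s t)) (F1 s t)) (scal (cos (theta s t)) (F2 s t)).

Lemma rotated_filament_frame I J T F1 F2 theta :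
  is_open_interval I -> is_open_interval J -> smooth I J theta ->
  filament_frame I J T F1 F2 ->
  filament_frame I J T (rotated1 theta F1 F2) (rotated2 theta F1 F2).
Proof.
intros hI hJ hth [hF1 hF2 hfr ev1 ev2].
assert (hc := smooth_cos I J theta hI hJ hth).
assert (hs := smooth_sin I J theta hI hJ hth).
split.
- now apply smooth_vec_plus; try apply smooth_vec_scal.
- apply smooth_vec_plus; try apply smooth_vec_scal; auto using smooth_opp.
- intros s t hs' ht'; destruct (hfr s t hs' ht') as [h1 [h2 [h3 [h4 [h5 h6]]]]].
  assert (pyth := sin2_cos2 (theta s t)); unfold Rsqr in pyth.
  unfold orthonormal_frame, rotated1, rotated2.
  rewrite !linner_plus, !linner_scal, !linner_plus_r, !linner_scal_r.
  rewrite (linner_sym (F2 s t) (F1 s t)), h1, h2, h3, h4, h5, h6.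
  repeat split; lra.
- intros s t hs' ht'; unfold rotated1, rotated2.
  rewrite !linner_plus_r, !linner_scal_r, ev1, ev2 by easy; ring.
- intros s t hs' ht'; unfold rotated1, rotated2.
  rewrite !linner_plus_r, !linner_scal_r, ev1, ev2 by easy; ring.
Qed.

(** A rotation of the normal plane by the angle [th] changes the connection form
    by [th']: normal planes are spacelike, so the rotation group is the Euclidean one. *)
Lemma rotation_connection (th : R -> R) (f1 f2 : R -> E13) (u th' : R) (f1' f2' : E13) :
  is_derive th u th' -> is_derive_vec f1 u f1' -> is_derive_vec f2 u f2' ->
  linner (f1 u) (f1 u) = 1 -> linner (f2 u) (f2 u) = 1 -> linner (f1 u) (f2 u) = 0 ->
  linner f1' (f1 u) = 0 -> linner f2' (f2 u) = 0 ->
  linner f2' (f1 u) = - linner f1' (f2 u) ->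
  linner (Derive_vec (fun z => plus (scal (cos (th z)) (f1 z)) (scal (sin (th z)) (f2 z))) u)
         (plus (scal (- sin (th u)) (f1 u)) (scal (cos (th u)) (f2 u)))
  = th' + linner f1' (f2 u).
Proof.
intros hth h1 h2 n1 n2 n12 o1 o2 o12.
assert (hc : is_derive (fun z => cos (th z)) u (th' * - sin (th u)))
  by exact (is_derive_comp (V := R_NormedModule) cos th u _ _ (is_derive_cos (th u)) hth).
assert (hs : is_derive (fun z => sin (th z)) u (th' * cos (th u)))
  by exact (is_derive_comp (V := R_NormedModule) sin th u _ _ (is_derive_sin (th u)) hth).
assert (e := is_derive_vec_unique _ _ _ (is_derive_vec_plus _ _ _ _ _
   (is_derive_vec_scal _ _ _ _ _ hc h1) (is_derive_vec_scal _ _ _ _ _ hs h2))).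
etransitivity; [exact (f_equal (fun d => linner d _) e)|]; cbv beta.
assert (pyth := sin2_cos2 (th u)); unfold Rsqr in pyth.
rewrite !linner_plus, !linner_scal, !linner_plus_r, !linner_scal_r.
rewrite (linner_sym (f2 u) (f1 u)), n1, n2, n12, o1, o2, o12.
transitivity ((th' + linner f1' (f2 u)) * (sin (th u) * sin (th u) + cos (th u) * cos (th u))).
  ring.
rewrite pyth; ring.
Qed.

(** For each [t] the parallel frame is unique up to a rotation angle depending on
    [t]; the prescribed value of [<E1_t, E2>] is what fixes this freedom, up to a
    constant. *)
Lemma exists_parallel_filament_frame I J T :
  is_open_interval I -> is_open_interval J -> smooth_vec I J T ->
  (forall s t, I s -> J t -> linner (T s t) (T s t) = -1) ->
  (forall s t, I s -> J t -> dt_vec T s t = lcross (T s t) (ds_vec (ds_vec T) s t)) ->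
  exists E1 E2, filament_frame I J T E1 E2 /\
    forall s t, I s -> J t ->
      linner (ds_vec E1 s t) (E2 s t) = 0 /\
      linner (dt_vec E1 s t) (E2 s t) = / 2 * linner (ds_vec T s t) (ds_vec T s t).
Proof.
intros hI hJ hT hunit hev.
destruct (exists_filament_frame I J T hI hJ hT hunit hev) as [F1 [F2 hF]].
assert (hF1 := ff_smooth1 _ _ _ _ _ hF); assert (hF2 := ff_smooth2 _ _ _ _ _ hF).
assert (dT := smooth_vec_ds _ _ _ hT).
destruct (closed_form_exact I J (fun s t => - linner (ds_vec F1 s t) (F2 s t))
  (fun s t => / 2 * linner (ds_vec T s t) (ds_vec T s t) - linner (dt_vec F1 s t) (F2 s t)))
  as [theta [hth hp]]; auto.
- apply smooth_opp, smooth_linner; auto using smooth_vec_ds.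
- apply smooth_minus; auto.
  + apply smooth_mult; auto using smooth_const, smooth_linner.
  + apply smooth_linner; auto using smooth_vec_dt.
- intros s t hs ht; now apply (connection_form_closed I J T).
exists (rotated1 theta F1 F2), (rotated2 theta F1 F2).
split; [now apply rotated_filament_frame|].
intros s t hs ht.
destruct (ff_frame _ _ _ _ _ hF s t hs ht) as [_ [n1 [n2 [_ [_ n12]]]]].
destruct (hp s t hs ht) as [ps pt].
split.
- destruct (filament_frame_skew_ds I J T F1 F2 s t) as [_ [o1 [o2 [_ [_ o12]]]]]; auto.
  assert (h := rotation_connection (fun u => theta u t) (fun u => F1 u t) (fun u => F2 u t) s
    _ _ _ ps (is_derive_ds_vec I J _ _ _ hF1 hs ht) (is_derive_ds_vec I J _ _ _ hF2 hs ht)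
    n1 n2 n12 o1 o2 o12).
  etransitivity; [exact h | cbv beta; ring].
- destruct (filament_frame_skew_dt I J T F1 F2 s t) as [_ [o1 [o2 [_ [_ o12]]]]]; auto.
  assert (h := rotation_connection (fun v => theta s v) (fun v => F1 s v) (fun v => F2 s v) t
    _ _ _ pt (is_derive_dt_vec I J _ _ _ hF1 hs ht) (is_derive_dt_vec I J _ _ _ hF2 hs ht)
    n1 n2 n12 o1 o2 o12).
  etransitivity; [exact h | cbv beta; ring].
Qed.

(** With [k1] and [k2] the products of [T_s] with the frame, the entries left open
    by skewness and by the hypotheses are the products of [T_t] with the frame.  They equal [- <T_ss, E2>] and [<T_ss, E1>],
    and these are the derivatives of the curvatures because [E1_s] and [E2_s] are
    multiples of [T], which is orthogonal to [T_s]. *)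
Lemma adapted_of_parallel_filament_frame I J alpha E1 E2 :
  is_open_interval I -> is_open_interval J -> smooth_vec I J alpha ->
  filament_frame I J (ds_vec alpha) E1 E2 ->
  (forall s t, I s -> J t ->
      linner (ds_vec E1 s t) (E2 s t) = 0 /\
      linner (dt_vec E1 s t) (E2 s t)
      = / 2 * linner (ds_vec (ds_vec alpha) s t) (ds_vec (ds_vec alpha) s t)) ->
  adapted_frame I J alpha E1 E2
    (fun s t => linner (ds_vec (ds_vec alpha) s t) (E1 s t))
    (fun s t => linner (ds_vec (ds_vec alpha) s t) (E2 s t)).
Proof.
intros hI hJ ha hE hpar.
set (T := ds_vec alpha) in *.
assert (hT : smooth_vec I J T) by now apply smooth_vec_ds.
assert (dT := smooth_vec_ds _ _ _ hT).
assert (hE1 := ff_smooth1 _ _ _ _ _ hE); assert (hE2 := ff_smooth2 _ _ _ _ _ hE).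
set (k1 := fun s t => linner (ds_vec T s t) (E1 s t)).
set (k2 := fun s t => linner (ds_vec T s t) (E2 s t)).
assert (eqs : frame_s_equations I J T E1 E2 k1 k2).
  intros s t hs ht; assert (hF := ff_frame _ _ _ _ _ hE s t hs ht); simpl.
  destruct (filament_frame_skew_ds I J T E1 E2 s t) as [s1 [s2 [s3 [s4 [s5 s6]]]]]; auto.
  destruct (hpar s t hs ht) as [p _].
  split; [|split]; apply eq_row; auto; rewrite ?s1, ?s4, ?s5, ?s6, ?p; unfold k1, k2; auto; ring.
assert (dsk : forall s t, I s -> J t ->
    ds k1 s t = linner (ds_vec (ds_vec T) s t) (E1 s t) /\
    ds k2 s t = linner (ds_vec (ds_vec T) s t) (E2 s t)).
  intros s t hs ht; unfold k1, k2.
  rewrite !(ds_linner I J) by auto.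
  destruct (eqs s t hs ht) as [_ [-> ->]].
  destruct (filament_frame_skew_ds I J T E1 E2 s t) as [s1 _]; auto.
  rewrite !(linner_sym (ds_vec T s t) (row _ _ _ _ _ _)), !linner_row.
  rewrite (linner_sym (T s t)), s1; split; ring.
split; [easy|split; [easy|split; [|split; [|split; [easy|]]]]].
- intros t ht s hs; change (Derive_vec (fun s => alpha s t) s) with (T s t).
  destruct (ff_frame _ _ _ _ _ hE s t hs ht) as [h1 [h2 [h3 [h4 [h5 h6]]]]].
  destruct (filament_frame_skew_ds I J T E1 E2 s t) as [_ [_ [_ [_ [_ s6]]]]]; auto.
  destruct (hpar s t hs ht) as [p _].
  repeat split; try easy.
  rewrite linner_sym; change (linner (ds_vec E2 s t) (E1 s t) = 0); rewrite s6, p; ring.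
- intros t ht s hs; destruct (eqs s t hs ht) as [e _].
  etransitivity; [exact e|]; unfold row; simpl.
  apply E13_eq; unfold plus, scal, x1, x2, x3; simpl; unfold plus, scal; simpl;
    unfold mult; simpl; ring.
- change (frame_t_equations I J T E1 E2 k1 k2).
  intros s t hs ht; assert (hF := ff_frame _ _ _ _ _ hE s t hs ht); simpl.
  destruct (filament_frame_skew_ds I J T E1 E2 s t) as [s1 _]; auto.
  destruct (filament_frame_skew_dt I J T E1 E2 s t) as [t1 [t2 [t3 [t4 [t5 t6]]]]]; auto.
  destruct (hpar s t hs ht) as [_ p].
  rewrite (parseval _ _ _ (ds_vec T s t) (ds_vec T s t) hF), s1 in p.
  destruct (dsk s t hs ht) as [-> ->].
  assert (ev1 := ff_evol1 _ _ _ _ _ hE s t hs ht).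
  assert (ev2 := ff_evol2 _ _ _ _ _ hE s t hs ht).
  split; [|split]; apply eq_row; auto; rewrite ?t1, ?t4, ?t5, ?t6, ?p, ?ev1, ?ev2;
    unfold k1, k2; auto; ring.
Qed.

(** * The nonlinear Schrodinger equation *)

Lemma adapted_frame_orthonormal I J alpha E1 E2 k1 k2 s t :
  adapted_frame I J alpha E1 E2 k1 k2 -> I s -> J t ->
  orthonormal_frame (ds_vec alpha s t) (E1 s t) (E2 s t).
Proof.
intros [_ [_ [h _]]] hs ht.
destruct (h t ht s hs) as [h1 [h2 [h3 [h4 [h5 [h6 _]]]]]].
now repeat split.
Qed.

Lemma linner_row_frame (T E1 E2 : E13) (a b c : R) :
  orthonormal_frame T E1 E2 ->
  linner (row a b c T E1 E2) T = - a /\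
  linner (row a b c T E1 E2) E1 = b /\
  linner (row a b c T E1 E2) E2 = c.
Proof.
intros [h1 [h2 [h3 [h4 [h5 h6]]]]]; rewrite !linner_row.
rewrite (linner_sym E1 T), (linner_sym E2 T), (linner_sym E2 E1).
rewrite h1, h2, h3, h4, h5, h6; repeat split; ring.
Qed.

(** Both [k_t] and [f_s] contain the mixed term [<T_st, E>]; eliminating it relates
    the evolution of a curvature [k] to the [s]-derivative of a coefficient [f] of
    [T_t]. *)
Lemma curvature_evolution I J T E k f s t :
  is_open_interval I -> is_open_interval J -> smooth_vec I J T -> smooth_vec I J E ->
  (forall s t, I s -> J t -> linner (ds_vec T s t) (E s t) = k s t) ->
  (forall s t, I s -> J t -> linner (dt_vec T s t) (E s t) = f s t) ->
  I s -> J t ->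
  dt k s t = ds f s t + linner (ds_vec T s t) (dt_vec E s t)
             - linner (dt_vec T s t) (ds_vec E s t).
Proof.
intros hI hJ hT hE hk hf hs ht.
assert (sT := smooth_vec_ds _ _ _ hT); assert (tT := smooth_vec_dt _ _ _ hT).
rewrite <- (dt_ext I J _ k s t hJ hk hs ht), <- (ds_ext I J _ f s t hI hf hs ht).
rewrite (dt_linner I J), (ds_linner I J), (ds_dt_vec_comm I J) by easy; ring.
Qed.

Lemma smooth_curvature I J T E k :
  is_open_interval I -> is_open_interval J -> smooth_vec I J T -> smooth_vec I J E ->
  (forall s t, I s -> J t -> linner (ds_vec T s t) (E s t) = k s t) ->
  smooth I J k.
Proof.
intros hI hJ hT hE hk.
apply (smooth_ext I J _ _ hI hJ hk).
apply smooth_linner; auto using smooth_vec_ds.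
Qed.

Lemma NLS_minus_of_real_parts I J k1 k2 :
  is_open_interval I -> is_open_interval J ->
  smooth I J k1 -> smooth I J k2 ->
  (forall s t, I s -> J t ->
     dt k1 s t = - ds (ds k2) s t + / 2 * (k1 s t ^ 2 + k2 s t ^ 2) * k2 s t /\
     dt k2 s t = ds (ds k1) s t - / 2 * (k1 s t ^ 2 + k2 s t ^ 2) * k1 s t) ->
  NLS_minus I J (fun s t => (RtoC (k1 s t) + Ci * RtoC (k2 s t))%C).
Proof.
intros hI hJ h1 h2 heq.
set (q := fun s t => (RtoC (k1 s t) + Ci * RtoC (k2 s t))%C).
assert (hq : forall s t, q s t = (k1 s t, k2 s t)).
  intros s t; unfold q, Cplus, Cmult, Ci, RtoC; simpl; f_equal; ring.
assert (tq : forall s t, dt_C q s t = (dt k1 s t, dt k2 s t)).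
  intros s t; unfold dt_C, Derive_C; f_equal; apply Derive_ext; intros u; now rewrite hq.
assert (sq : forall s t, ds_C q s t = (ds k1 s t, ds k2 s t)).
  intros s t; unfold ds_C, Derive_C; f_equal; apply Derive_ext; intros u; now rewrite hq.
assert (ssq : forall s t, ds_C (ds_C q) s t = (ds (ds k1) s t, ds (ds k2) s t)).
  intros s t; unfold ds_C at 1, Derive_C; f_equal; apply Derive_ext; intros u; now rewrite sq.
split.
- split; [apply (smooth_ext I J k1) | apply (smooth_ext I J k2)]; auto;
    intros s t _ _; fold (q s t); now rewrite hq.
- intros s t hs ht; destruct (heq s t hs ht) as [e1 e2].
  rewrite tq, ssq, hq, e1, e2.
  unfold Cmod; rewrite pow2_sqrt by (simpl; nra).
  unfold Cminus, Cplus, Copp, Cmult, Ci, RtoC; simpl; f_equal; ring.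
Qed.

(** The two real equations are [k1_t = - k2_ss + w k2] and [k2_t = k1_ss - w k1]
    with [w = 1/2 (k1^2 + k2^2)]: the curvature evolution with [f] equal to [- k2_s]
    and to [k1_s].  The frame equations evaluate the remaining products, and only
    the rotation rate [w] of the normal plane survives. *)
Lemma adapted_frame_NLS I J alpha E1 E2 k1 k2 :
  is_open_interval I -> is_open_interval J -> smooth_vec I J alpha ->
  adapted_frame I J alpha E1 E2 k1 k2 ->
  NLS_minus I J (fun s t => (RtoC (k1 s t) + Ci * RtoC (k2 s t))%C).
Proof.
intros hI hJ ha had.
assert (hF := fun s t => adapted_frame_orthonormal _ _ _ _ _ _ _ s t had).
destruct had as [hE1 [hE2 [_ [_ [hes het]]]]].
assert (hT := smooth_vec_ds _ _ _ ha).
set (T := ds_vec alpha) in *.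
assert (hk1 : forall s t, I s -> J t -> linner (ds_vec T s t) (E1 s t) = k1 s t).
  intros s t hs ht; destruct (hes s t hs ht) as [-> _]; now apply linner_row_frame, hF.
assert (hk2 : forall s t, I s -> J t -> linner (ds_vec T s t) (E2 s t) = k2 s t).
  intros s t hs ht; destruct (hes s t hs ht) as [-> _]; now apply linner_row_frame, hF.
assert (hf1 : forall s t, I s -> J t -> linner (dt_vec T s t) (E1 s t) = - ds k2 s t).
  intros s t hs ht; destruct (het s t hs ht) as [-> _]; now apply linner_row_frame, hF.
assert (hf2 : forall s t, I s -> J t -> linner (dt_vec T s t) (E2 s t) = ds k1 s t).
  intros s t hs ht; destruct (het s t hs ht) as [-> _]; now apply linner_row_frame, hF.
apply NLS_minus_of_real_parts; auto.
- now apply (smooth_curvature I J T E1).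
- now apply (smooth_curvature I J T E2).
- intros s t hs ht.
  destruct (linner_row_frame _ _ _ 0 (k1 s t) (k2 s t) (hF s t hs ht)) as [sT [sE1 sE2]].
  destruct (linner_row_frame _ _ _ 0 (- ds k2 s t) (ds k1 s t) (hF s t hs ht)) as [tT _].
  destruct (hes s t hs ht) as [e0 [e1 e2]]; destruct (het s t hs ht) as [f0 [f1 f2]].
  rewrite (curvature_evolution I J T E1 k1 _ s t hI hJ hT hE1 hk1 hf1 hs ht).
  rewrite (curvature_evolution I J T E2 k2 _ s t hI hJ hT hE2 hk2 hf2 hs ht).
  replace (ds (fun s t => - ds k2 s t) s t) with (- ds (ds k2) s t)
    by (symmetry; exact (Derive_opp (fun u => ds k2 u t) s)).
  rewrite e0, e1, e2, f0, f1, f2.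
  rewrite 4!linner_row_r, sT, sE1, sE2, tT.
  split; ring.
Qed.

Theorem theorem3p3 (I J : R -> Prop) (alpha : R -> R -> E13)
    (hI : is_open_interval I) (hJ : is_open_interval J) (hJ0 : J 0)
    (halpha : smooth_vec I J alpha)
    (hvfe : vortex_filament I J alpha)
    (htimelike : forall t, J t -> timelike_curve I (fun s => alpha s t))
    (hunit : forall s, I s -> lnorm (ds_vec alpha s 0) = 1) :
  (exists (E1 E2 : R -> R -> E13) (k1 k2 : R -> R -> R),
     adapted_frame I J alpha E1 E2 k1 k2) /\
  (forall (E1 E2 : R -> R -> E13) (k1 k2 : R -> R -> R),
     adapted_frame I J alpha E1 E2 k1 k2 ->
     NLS_minus I J (fun s t => (RtoC (k1 s t) + Ci * RtoC (k2 s t))%C)).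
Proof.
split.
- assert (hT := smooth_vec_ds _ _ _ halpha).
  assert (hev := fun s t => tangent_evolution I J alpha s t hI hJ halpha hvfe).
  assert (hTT : forall s t, I s -> J t -> linner (ds_vec alpha s t) (ds_vec alpha s t) = -1).
    apply (tangent_unit I J (ds_vec alpha)); auto.
    + intros s t hs ht; rewrite hev by easy; apply linner_lcross_l.
    + intros s hs; split; [exact (htimelike 0 hJ0 s hs) | now apply hunit].
  destruct (exists_parallel_filament_frame I J (ds_vec alpha) hI hJ hT hTT hev)
    as [E1 [E2 [hE hpar]]].
  eexists E1, E2, _, _; now apply adapted_of_parallel_filament_frame.
- intros E1 E2 k1 k2; now apply adapted_frame_NLS.
Qed.
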